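(* Let $c_*>0$ be any constant. (a) For 3-Majority started from any initial configuration, with high probability there exists $T=O(\sqrt n(\log n)^2)$ such that $\gamma_T\ge c_*\log n/\sqrt n$. (b) For 2-Choices started from any initial configuration, with high probability there exists $T=O(n(\log n)^3)$ such that $\gamma_T\ge c_*(\log n)^2/n$.
   Context: **Setting.** Let $V$ be a set of $n$ vertices and $k\in\{1,\dots,n\}$. A configuration is a map $\mathsf{opn}\colon V\to[k]$. The process is synchronous: each round $t\ge1$ produces $\mathsf{opn}_t$ from $\mathsf{opn}_{t-1}$, and all vertices make their choices independently. **3-Majority.** Each vertex $v$ samples $w_1,w_2,w_3\in V$ independently and uniformly, with replacement. It sets $\mathsf{opn}_t(v)=\mathsf{opn}_{t-1}(w_1)$ if $\mathsf{opn}_{t-1}(w_1)=\mathsf{opn}_{t-1}(w_2)$, and $\mathsf{opn}_t(v)=\mathsf{opn}_{t-1}(w_3)$ otherwise. **2-Choices.** Each vertex $v$ samples $w_1,w_2\in V$ independently and uniformly, with replacement. It sets $\mathsf{opn}_t(v)=\mathsf{opn}_{t-1}(w_1)$ if $\mathsf{opn}_{t-1}(w_1)=\mathsf{opn}_{t-1}(w_2)$, and $\mathsf{opn}_t(v)=\mathsf{opn}_{t-1}(v)$ otherwise. **Basic quantities.** - $\alpha_t(i)=|\{v:\mathsf{opn}_t(v)=i\}|/n$. - $\gamma_t=\sum_{i\in[k]}\alpha_t(i)^2$. **Conventions.** ''With high probability'' means with probability $1-O(n^{-c})$ for some constant $c>0$. The $O(\cdot)$ constants may depend on $c_*$ only.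 *)

(* Defs.v *)
From HB Require Import structures.
From mathcomp Require Import all_boot all_order all_algebra.
From mathcomp Require Import all_classical all_reals all_analysis.
Set Implicit Arguments. Unset Strict Implicit. Unset Printing Implicit Defensive.
Import Order.TTheory GRing.Theory Num.Theory.
Local Open Scope ring_scope.

(* Vertex set V = 'I_n, opinions [k] = 'I_k. A configuration opn : V -> [k]. *)
Definition config (n k : nat) := {ffun 'I_n -> 'I_k}.

Definition alpha (R : realType) n k (x : config n k) (i : 'I_k) : R :=
  #|[set v | x v == i]|%:R / n%:R.

Definition gamma (R : realType) n k (x : config n k) : R :=
  \sum_(i < k) alpha R x i ^+ 2.

Definition maj3_out n k (x : config n k) (w : 'I_n * 'I_n * 'I_n) : 'I_k :=
  let: (w1, w2, w3) := w in if x w1 == x w2 then x w1 else x w3.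

Definition choice2_out n k (x : config n k) (v : 'I_n) (w : 'I_n * 'I_n) : 'I_k :=
  let: (w1, w2) := w in if x w1 == x w2 then x w1 else x v.

(* Probability that vertex v adopts opinion j in one round (samples are
   independent, uniform, with replacement). *)
Definition maj3_upd (R : realType) n k (x : config n k) (v : 'I_n) (j : 'I_k) : R :=
  #|[set w | maj3_out x w == j]|%:R / (n%:R ^+ 3).

Definition choice2_upd (R : realType) n k (x : config n k) (v : 'I_n) (j : 'I_k) : R :=
  #|[set w | choice2_out x v w == j]|%:R / (n%:R ^+ 2).

(* Synchronous round: vertices choose independently, so the transition
   probability x -> y is the product of the per-vertex probabilities. *)
Definition step_prob (R : realType) n k
  (upd : config n k -> 'I_n -> 'I_k -> R) (x y : config n k) : R :=
  \prod_(v < n) upd x v (y v).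

Definition traj n k L := {ffun 'I_L.+1 -> config n k}.

Definition traj_weight (R : realType) n k
  (upd : config n k -> 'I_n -> 'I_k -> R) (x0 : config n k) L
  (tr : traj n k L) : R :=
  (tr ord0 == x0)%:R *
  \prod_(t < L) step_prob upd (tr (inord t)) (tr (inord t.+1)).

Definition prob_event (R : realType) n k
  (upd : config n k -> 'I_n -> 'I_k -> R) (x0 : config n k) L
  (A : pred (traj n k L)) : R :=
  \sum_(tr : traj n k L | A tr) traj_weight upd x0 tr.

Definition hits_gamma (R : realType) n k L (thr : R) : pred (traj n k L) :=
  fun tr => [exists t : 'I_L.+1, thr <= gamma R (tr t)].

(* Main.v *)
(** The mean of [gamma] after a round is the sum of the squares of the mean
    fractions [alpha (1 + alpha - gamma)], which is at least [gamma], plus the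
    sum of the variances of the new fractions.  The latter
    is of order [rho / n], where [rho] bounds the probability that a
    vertex changes its opinion: [rho = 1] for 3-Majority and [rho = gamma >= 1/n]
    for 2-Choices.  The Efron-Stein inequality bounds the variance of the new
    [gamma] by [(4 rho / n) E gamma], so as long as [gamma < thr] the bounded
    potential [gamma - gamma ^ 2 / (160 thr)] still gains [rho / (8 n)] per round
    in expectation.  Hence from every configuration the threshold is missed for
    [O(n thr / rho)] rounds with probability at most [1 / e], and repeating this
    [ln n] times gives failure probability at most [1 / n]. *)
Require Import Defs.
From HB Require Import structures.
From mathcomp Require Import all_boot all_order all_algebra.
From mathcomp Require Import all_classical all_reals all_analysis.
From mathcomp Require Import ring lra.
Set Implicit Arguments. Unset Strict Implicit. Unset Printing Implicit Defensive.
Import Order.TTheory GRing.Theory Num.Theory.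
Local Open Scope ring_scope.

(** * Product measures: averaging over one coordinate and the Efron-Stein inequality *)

Section ProductMeasure.
Variables (R : realFieldType) (V J : finType) (q : V -> J -> R).
Hypothesis q_ge0 : forall v j, 0 <= q v j.
Hypothesis q_sum1 : forall v, \sum_j q v j = 1.
Implicit Types (F G : {ffun V -> J} -> R) (y z : {ffun V -> J}).

Definition prod_weight y : R := \prod_v q v (y v).

Definition expect F : R := \sum_y prod_weight y * F y.

Definition update y (v : V) (j : J) : {ffun V -> J} :=
  [ffun u => if u == v then j else y u].

Definition avg (v : V) F y : R := \sum_j q v j * F (update y v j).

Lemma prod_weight_ge0 y : 0 <= prod_weight y.
Proof. exact: prodr_ge0. Qed.

Lemma sum_prod_weight : \sum_y prod_weight y = 1.
Proof.
by rewrite /prod_weight -bigA_distr_bigA big1 // => v _; rewrite q_sum1.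
Qed.

Lemma expect_cst c : expect (fun=> c) = c.
Proof. by rewrite /expect -mulr_suml sum_prod_weight mul1r. Qed.

Lemma eq_expect F G : F =1 G -> expect F = expect G.
Proof. by move=> FG; apply: eq_bigr => y _; rewrite FG. Qed.

Lemma ler_expect F G : (forall y, F y <= G y) -> expect F <= expect G.
Proof. by move=> FG; apply: ler_sum => y _; rewrite ler_wpM2l ?prod_weight_ge0. Qed.

Lemma expectD F G : expect (fun y => F y + G y) = expect F + expect G.
Proof. by rewrite -big_split; apply: eq_bigr => y _; rewrite mulrDr. Qed.

Lemma expectZ c F : expect (fun y => c * F y) = c * expect F.
Proof. by rewrite mulr_sumr; apply: eq_bigr => y _; rewrite mulrCA. Qed.

Lemma expectB F G : expect (fun y => F y - G y) = expect F - expect G.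
Proof.
by rewrite -[- expect G]mulN1r -expectZ -expectD; apply: eq_expect => y; rewrite mulN1r.
Qed.

Lemma expect_sum (I : finType) (F : I -> {ffun V -> J} -> R) :
  expect (fun y => \sum_i F i y) = \sum_i expect (F i).
Proof.
by rewrite exchange_big; apply: eq_bigr => y _; rewrite mulr_sumr.
Qed.

Lemma updateE y v j u : update y v j u = if u == v then j else y u.
Proof. by rewrite ffunE. Qed.

Lemma update_update y v i j : update (update y v i) v j = update y v j.
Proof. by apply/ffunP=> u; rewrite !ffunE; case: eqP. Qed.

Lemma update_id y v : update y v (y v) = y.
Proof. by apply/ffunP=> u; rewrite ffunE; case: eqP => // ->. Qed.

Lemma updateC y u v i j : u != v ->
  update (update y u i) v j = update (update y v j) u i.
Proof.
move=> uv; apply/ffunP=> w; rewrite !ffunE.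
by case: (eqVneq w v) => // ->; rewrite eq_sym (negbTE uv).
Qed.

(** Kept in multiplied form because [q v (y v)] may vanish. *)
Lemma prod_weight_update y v j :
  prod_weight (update y v j) * q v (y v) = prod_weight y * q v j.
Proof.
rewrite /prod_weight !(bigD1 (P := xpredT) v) //= updateE eqxx mulrAC [RHS]mulrAC.
rewrite [q v j * _]mulrC; congr (_ * _).
by apply: eq_bigr => u /negbTE uv; rewrite updateE uv.
Qed.

Lemma expect_avg v F : expect (avg v F) = expect F.
Proof.
rewrite /expect /avg; under eq_bigr do rewrite mulr_sumr.
rewrite pair_big /=.
(* [h] swaps the value at [v] with the fresh sample; by [prod_weight_update] it preserves the joint
   weight of the pair. *)
pose h (p : {ffun V -> J} * J) := (update p.1 v p.2, p.1 v).
have hK : involutive h.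
  by case=> y j; rewrite /h /= update_update update_id updateE eqxx.
rewrite (reindex_inj (inv_inj hK)) /=.
rewrite -(pair_big xpredT xpredT
  (fun y j => prod_weight (update y v j) * (q v (y v) * F (update (update y v j) v (y v))))) /=.
apply: eq_bigr => y _; under eq_bigr => j _.
  rewrite update_update update_id mulrA prod_weight_update mulrAC; over.
by rewrite -mulr_sumr q_sum1 mulr1.
Qed.

Lemma avg_update v F y j : avg v F (update y v j) = avg v F y.
Proof. by apply: eq_bigr => i _; rewrite update_update. Qed.

Lemma eq_avg v F G : F =1 G -> avg v F =1 avg v G.
Proof. by move=> FG y; apply: eq_bigr => j _; rewrite FG. Qed.

Lemma avgC u v F : avg u (avg v F) =1 avg v (avg u F).
Proof.
move=> y; rewrite /avg; case: (eqVneq u v) => [-> //|uv].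
under eq_bigr do rewrite mulr_sumr.
rewrite exchange_big /=; apply: eq_bigr => j _; rewrite mulr_sumr.
by apply: eq_bigr => i _; rewrite updateC // mulrCA.
Qed.

Lemma avgB v F G y : avg v (fun z => F z - G z) y = avg v F y - avg v G y.
Proof. by rewrite -sumrB; apply: eq_bigr => j _; rewrite mulrBr. Qed.

(** Pythagoras: [avg v] is the orthogonal projection onto the functions that ignore coordinate
    [v]. *)
Lemma expect_sqr_avg v F :
  expect (fun y => (F y - avg v F y) ^+ 2) =
  expect (fun y => F y ^+ 2) - expect (fun y => avg v F y ^+ 2).
Proof.
have cross : expect (fun y => F y * avg v F y) = expect (fun y => avg v F y ^+ 2).
  rewrite -(expect_avg v); apply: eq_expect => y.
  transitivity (\sum_j q v j * F (update y v j) * avg v F y).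
    by apply: eq_bigr => j _; rewrite avg_update mulrA.
  by rewrite -mulr_suml expr2.
rewrite (eq_expect (G := fun y => F y ^+ 2 - 2 * (F y * avg v F y) + avg v F y ^+ 2)).
  by rewrite expectD expectB expectZ cross; ring.
by move=> y; ring.
Qed.

Lemma expect_sqr_avg_le v F :
  expect (fun y => avg v F y ^+ 2) <= expect (fun y => F y ^+ 2).
Proof.
rewrite -subr_ge0 -expect_sqr_avg; apply: sumr_ge0 => y _.
by rewrite mulr_ge0 ?prod_weight_ge0 ?sqr_ge0.
Qed.

Definition avgs (s : seq V) F := foldr avg F s.

Lemma avgs_avg s v F : avgs s (avg v F) =1 avg v (avgs s F).
Proof.
by elim: s => //= u s IHs y; rewrite (eq_avg _ IHs) avgC.
Qed.

Lemma avgsB s F G y : avgs s (fun z => F z - G z) y = avgs s F y - avgs s G y.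
Proof. by elim: s y => //= u s IHs y; rewrite (eq_avg _ IHs) avgB. Qed.

Lemma expect_avgs s F : expect (avgs s F) = expect F.
Proof. by elim: s => //= v s IHs; rewrite expect_avg. Qed.

Lemma expect_sqr_avgs_le s F :
  expect (fun y => avgs s F y ^+ 2) <= expect (fun y => F y ^+ 2).
Proof. by elim: s => //= v s; apply: le_trans; apply: expect_sqr_avg_le. Qed.

Lemma avgs_depends s F y z :
  (forall u, u \notin s -> y u = z u) -> avgs s F y = avgs s F z.
Proof.
elim: s y z => /= [|v s IHs] y z yz; first by congr F; apply/ffunP=> u; apply: yz.
apply: eq_bigr => j _; congr (_ * _); apply: IHs => u us; rewrite !updateE.
by case: eqVneq => // uv; apply: yz; rewrite inE negb_or uv.
Qed.

Lemma avgs_enum F y : avgs (enum V) F y = expect F.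
Proof.
rewrite -(expect_avgs (enum V)) -[LHS]expect_cst; apply: eq_expect => z.
by apply: avgs_depends => u; rewrite mem_enum.
Qed.

(** Telescoping over [s]. Averaging over one more coordinate [v] loses the second moment of
    [avgs s (F - avg v F)], because averages commute, and [avgs s] is an L2 contraction. *)
Lemma expect_sqr_avgs_sub s F :
  expect (fun y => F y ^+ 2) - expect (fun y => avgs s F y ^+ 2) <=
  \sum_(v <- s) expect (fun y => (F y - avg v F y) ^+ 2).
Proof.
elim: s => [|v s IHs]; first by rewrite big_nil subrr.
rewrite big_cons /= -(subrKA (expect (fun y => avgs s F y ^+ 2))) addrC.
rewrite lerD // -expect_sqr_avg.
rewrite (eq_expect (G := fun y => avgs s (fun z => F z - avg v F z) y ^+ 2)).
  exact: expect_sqr_avgs_le.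
by move=> y; rewrite avgsB avgs_avg.
Qed.

(* Efron-Stein inequality, with the resampled coordinate replaced by a fixed
   reference value [x v]. *)
Lemma efron_stein (x : {ffun V -> J}) F :
  expect (fun y => F y ^+ 2) - expect F ^+ 2 <=
  \sum_v expect (fun y => (F y - F (update y v (x v))) ^+ 2).
Proof.
have -> : expect F ^+ 2 = expect (fun y => avgs (enum V) F y ^+ 2).
  by rewrite -[LHS]expect_cst; apply: eq_expect => y; rewrite avgs_enum.
apply: le_trans (expect_sqr_avgs_sub _ _) _; rewrite big_enum /=.
(* The subtracted term ignores coordinate [v], so [F] and [D] have the same fluctuation around their
   [v]-averages; that of [D] is at most its second moment. *)
apply: ler_sum => v _; pose D y := F y - F (update y v (x v)).
rewrite (eq_expect (G := fun y => (D y - avg v D y) ^+ 2)).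
  rewrite expect_sqr_avg gerBl.
  by apply: sumr_ge0 => y _; rewrite mulr_ge0 ?prod_weight_ge0 ?sqr_ge0.
move=> y; rewrite avgB; congr (_ ^+ 2).
have -> : avg v (fun z => F (update z v (x v))) y = F (update y v (x v)).
  by rewrite /avg; under eq_bigr do rewrite update_update;
     rewrite -mulr_suml q_sum1 mul1r.
by rewrite /D; ring.
Qed.

Lemma expect_coord v (g : J -> R) :
  expect (fun y => g (y v)) = \sum_j q v j * g j.
Proof.
rewrite -(expect_avg v) -[RHS]expect_cst; apply: eq_expect => y.
by apply: eq_bigr => j _; rewrite updateE eqxx.
Qed.

Lemma expect_coord2 u v (g h : J -> R) : u != v ->
  expect (fun y => g (y u) * h (y v)) =
  (\sum_j q u j * g j) * (\sum_j q v j * h j).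
Proof.
move=> uv; rewrite -(expect_avg v).
rewrite (eq_expect (G := fun y => (\sum_j q v j * h j) * g (y u))).
  by rewrite expectZ expect_coord mulrC.
move=> y; rewrite mulr_suml; apply: eq_bigr => j _.
by rewrite !updateE eqxx (negbTE uv); ring.
Qed.

End ProductMeasure.

(** * Finite Markov chains killed outside a set: survival probabilities and additive drift *)

Section KilledChain.
Variables (R : realFieldType) (S : finType) (M : S -> S -> R) (ok : pred S).
Hypothesis M_ge0 : forall x y, 0 <= M x y.
Hypothesis M_sum1 : forall x, \sum_y M x y = 1.
Implicit Types (h f : S -> R) (x y : S).

Definition kill h x : R := (ok x)%:R * \sum_y M x y * h y.

(* The probability that the first N states of the chain started at x satisfy
   [ok]; the state reached after N steps is not tested. *)
Definition survival N : S -> R := iter N kill (fun=> 1).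

Lemma ler_kill h1 h2 x : (forall y, h1 y <= h2 y) -> kill h1 x <= kill h2 x.
Proof. by move=> h12; rewrite ler_wpM2l ?ler0n // ler_sum // => y _; rewrite ler_wpM2l. Qed.

Lemma killZ c h x : kill (fun y => c * h y) x = c * kill h x.
Proof.
by rewrite /kill mulrCA [c * _]mulr_sumr; congr (_ * _); apply: eq_bigr => y _; rewrite mulrCA.
Qed.

Lemma survival_ge0 N x : 0 <= survival N x.
Proof.
elim: N x => //= N IHN x; rewrite mulr_ge0 ?ler0n // sumr_ge0 // => y _.
by rewrite mulr_ge0.
Qed.

Lemma survival_succ_le N x : survival N.+1 x <= survival N x.
Proof.
elim: N x => [|N IHN] x; last exact: ler_kill.
rewrite /= /kill; under eq_bigr do rewrite mulr1.
by rewrite M_sum1 mulr1 lern1 leq_b1.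
Qed.

Lemma survival_mono m N x : (m <= N)%N -> survival N x <= survival m x.
Proof.
move=> /subnK <-; elim: (N - m)%N => // d; apply: le_trans.
by rewrite addSn survival_succ_le.
Qed.

(** Markov property after [s] steps. *)
Lemma survival_add s t c x : (forall y, survival t y <= c) ->
  survival (s + t) x <= c * survival s x.
Proof.
move=> tc; elim: s x => [|s IHs] x; first by rewrite add0n mulr1.
by rewrite addSn /= -killZ; apply: ler_kill.
Qed.

Lemma survival_mul r N c x : (forall y, survival N y <= c) ->
  survival (r * N) x <= c ^+ r.
Proof.
move=> Nc; elim: r x => [|r IHr] x //.
have c0 : 0 <= c by apply: le_trans (Nc x); apply: survival_ge0.
rewrite mulSn addnC exprS; apply: le_trans (survival_add _ _ Nc) _.
by rewrite ler_wpM2l.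
Qed.

(* Additive drift: f grows by d in expectation on [ok] states and never
   exceeds B, so the expected time spent in [ok] states is at most B / d. *)
Lemma survival_drift f (B d : R) N x : 0 <= d -> 0 <= B ->
  (forall y, f y <= B) -> (forall y, ok y -> 0 <= f y) ->
  (forall y, ok y -> f y + d <= \sum_z M y z * f z) ->
  N%:R * d * survival N x <= B.
Proof.
move=> d0 B0 fB f0 fd.
(* The sum is the expected length of the initial run of [ok] states among the first [N]; each of
   them uses up at least [d] of the budget [B - f y] in expectation. *)
have sum_le y : d * \sum_(i < N) survival i.+1 y <= B - f y.
  elim: N y => [|m IHm] y; first by rewrite big_ord0 mulr0 subr_ge0.
  have -> : \sum_(i < m.+1) survival i.+1 y =
    (ok y)%:R * \sum_z M y z * (1 + \sum_(i < m) survival i.+1 z).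
    rewrite big_ord_recl /= {1}/kill -mulr_sumr -mulrDr; congr (_ * _).
    rewrite exchange_big -big_split; apply: eq_bigr => z _ /=.
    by rewrite -mulr_sumr -mulrDr.
  case oky: (ok y); last by rewrite mul0r mulr0 subr_ge0.
  rewrite mul1r mulr_sumr.
  have : \sum_z d * (M y z * (1 + \sum_(i < m) survival i.+1 z)) <=
         \sum_z M y z * (d + (B - f z)).
    apply: ler_sum => z _; rewrite mulrCA ler_wpM2l // mulrDr mulr1.
    by rewrite lerD2l.
  move/le_trans; apply.
  have -> : \sum_z M y z * (d + (B - f z)) = d + B - \sum_z M y z * f z.
    rewrite -[d + B]mul1r -(M_sum1 y) mulr_suml -sumrB.
    by apply: eq_bigr => z _; ring.
  have := fd y oky; lra.
(* [f] may be negative outside [ok]; from such a start the survival probability is zero unless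
   [N = 0]. *)
have [okx|nokx] := boolP (ok x); last first.
  case: N sum_le => [|m] _; first by rewrite !mul0r.
  by rewrite /= /kill (negbTE nokx) mul0r mulr0.
apply: le_trans (_ : B - f x <= _); last by rewrite gerBl f0.
(* Survival is nonincreasing in time, so each of the [N] summands is at least [survival N x]. *)
apply: le_trans (sum_le x); rewrite mulrAC mulrC ler_wpM2l //.
rewrite mulr_natl -[N in _ *+ N]card_ord -sumr_const; apply: ler_sum => i _.
exact: survival_mono.
Qed.

Definition walk_weight L (x0 : S) (tr : {ffun 'I_L.+1 -> S}) : R :=
  (tr ord0 == x0)%:R * \prod_(t < L) M (tr (inord t)) (tr (inord t.+1)).

(** Induction on the length, splitting off the first state. All [L.+1] states of the walk are
    tested, hence [survival L.+1]. *)
Lemma sum_walk_ok L x0 :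
  \sum_(tr : {ffun 'I_L.+1 -> S}) walk_weight x0 tr * \prod_t (ok (tr t))%:R =
  survival L.+1 x0.
Proof.
elim: L x0 => [|L IHL] x0.
  rewrite (reindex (fun x => [ffun=> x] : {ffun 'I_1 -> S})) /=; last first.
    exists (fun tr => tr ord0) => [x|tr] _; first by rewrite ffunE.
    by apply/ffunP=> i; rewrite ffunE (ord1 i).
  under eq_bigr => x _.
    rewrite /walk_weight big_ord0 mulr1 big_ord1 !ffunE; over.
  rewrite (bigD1 x0) //= eqxx mul1r big1 ?addr0; last first.
    by move=> x /negbTE ->; rewrite mul0r.
  by rewrite /kill; under eq_bigr do rewrite mulr1; rewrite M_sum1 mulr1.
have -> : survival L.+2 x0 = (ok x0)%:R * \sum_y M x0 y *
    \sum_(tr : {ffun 'I_L.+1 -> S}) walk_weight y tr * \prod_t (ok (tr t))%:R.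
  by congr (_ * _); apply: eq_bigr => y _; rewrite IHL.
pose cons (p : S * {ffun 'I_L.+1 -> S}) : {ffun 'I_L.+2 -> S} :=
  [ffun i => if unlift ord0 i is Some j then p.2 j else p.1].
have cons0 p : cons p ord0 = p.1 by rewrite ffunE unlift_none.
have consS p j : cons p (lift ord0 j) = p.2 j by rewrite ffunE liftK.
rewrite (reindex cons) /=; last first.
  exists (fun tr => (tr ord0, [ffun j => tr (lift ord0 j)])) => [[x tr]|tr] _ /=.
    by congr pair; [exact: cons0|apply/ffunP=> j; rewrite ffunE consS].
  by apply/ffunP=> i; case: (unliftP ord0 i) => [j|] ->; rewrite ?consS ?cons0 ?ffunE.
rewrite -(pair_big xpredT xpredT (fun x tr => walk_weight x0 (cons (x, tr)) *
  \prod_t (ok (cons (x, tr) t))%:R)) /= (bigD1 x0) //= addrC big1 ?add0r; last first.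
  move=> x /negbTE xx0; apply: big1 => tr _.
  by rewrite /walk_weight cons0 xx0 !mul0r.
(* Transitions are indexed through [inord], which commutes with the shift only within range. *)
have inordS (m : nat) : (m <= L)%N -> inord m.+1 = lift ord0 (inord m : 'I_L.+1) :> 'I_L.+2.
  by move=> mL; apply: val_inj; rewrite /= !inordK // ltnS.
under [in RHS]eq_bigr do rewrite mulr_sumr.
rewrite exchange_big mulr_sumr; apply: eq_bigr => tr _ /=.
(* The initial-state indicator of the shorter walk collapses the sum over [y] to [y = tr ord0]. *)
rewrite (bigD1 (tr ord0)) //= [X in _ + X]big1 ?addr0; last first.
  by move=> y; rewrite /walk_weight eq_sym => /negbTE ->; rewrite !mul0r mulr0.
rewrite /walk_weight cons0 !eqxx !mul1r big_ord_recl [in X in _ * X]big_ord_recl cons0.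
under [X in _ * (_ * X) = _]eq_bigr do rewrite consS.
have -> : inord (@ord0 L) = ord0 :> 'I_L.+2 by apply: val_inj; rewrite /= inordK.
rewrite cons0 inordS // consS.
have -> : inord 0 = ord0 :> 'I_L.+1 by apply: val_inj; rewrite /= inordK.
have -> : \prod_(i < L) M (cons (x0, tr) (inord (lift ord0 i)))
    (cons (x0, tr) (inord (lift ord0 i).+1)) =
    \prod_(i < L) M (tr (inord i)) (tr (inord i.+1)).
  apply: eq_bigr => i _; rewrite [lift ord0 i : nat]/= /bump leq0n add1n.
  by rewrite !inordS ?consS // ltnW.
by rewrite /=; ring.
Qed.

End KilledChain.

Lemma survival_predT (R : realFieldType) (S : finType) (M : S -> S -> R) N x :
  (forall y, \sum_z M y z = 1) -> survival M xpredT N x = 1.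
Proof.
move=> M1; elim: N x => //= N IHN x; rewrite /kill mul1r.
by under eq_bigr do rewrite IHN mulr1.
Qed.

(** Complementation: the total weight of all walks is the survival probability for [xpredT], which
    is 1. *)
Lemma sum_walk_hit (R : realFieldType) (S : finType) (M : S -> S -> R)
    (ok : pred S) L x0 : (forall y, \sum_z M y z = 1) ->
  \sum_(tr : {ffun 'I_L.+1 -> S} | [exists t, ~~ ok (tr t)]) walk_weight M x0 tr =
  1 - survival M ok L.+1 x0.
Proof.
move=> M1; rewrite -(survival_predT L.+1 x0 M1) -!sum_walk_ok //.
under [X in X - _]eq_bigr do rewrite big1_eq mulr1.
rewrite -sumrB big_mkcond; apply: eq_bigr => tr _.
case: ifPn => [/existsP[t nok]|].
  by rewrite (bigD1 t) //= (negbTE nok) mul0r mulr0 subr0.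
rewrite negb_exists => /forallP allok; rewrite big1 ?mulr1 ?subrr //.
by move=> t _; have := allok t; rewrite negbK => ->.
Qed.

(** * Opinion fractions and the one-round laws of a vertex *)

Section Opinions.
Variables (R : realType) (n k : nat).
Hypothesis n_gt0 : (0 < n)%N.
Implicit Types (x y : config n k) (i j : 'I_k) (v : 'I_n).

Let n_neq0 : n%:R != 0 :> R. Proof. by rewrite pnatr_eq0 -lt0n. Qed.
Let n_pos : 0 < n%:R :> R. Proof. by rewrite ltr0n. Qed.

Lemma natr_card_set (T : finType) (P : pred T) :
  #|[set w | P w]|%:R = \sum_w (P w)%:R :> R.
Proof.
rewrite -sum1_card natr_sum big_mkcond /=; apply: eq_bigr => w _.
by rewrite inE; case: (P w).
Qed.

Lemma alpha_count x i : n%:R * alpha R x i = \sum_v (x v == i)%:R.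
Proof. by rewrite /alpha natr_card_set mulrC divfK. Qed.

Lemma sum_opinion x (g : 'I_k -> R) :
  \sum_v g (x v) = n%:R * \sum_i alpha R x i * g i.
Proof.
rewrite mulr_sumr; under [RHS]eq_bigr do rewrite mulrA alpha_count mulr_suml.
rewrite exchange_big; apply: eq_bigr => v _ /=.
rewrite (bigD1 (x v)) //= eqxx mul1r big1 ?addr0 // => i.
by rewrite eq_sym => /negbTE ->; rewrite mul0r.
Qed.

Lemma alpha_ge0 x i : 0 <= alpha R x i.
Proof. by rewrite divr_ge0. Qed.

Lemma sum_alpha x : \sum_i alpha R x i = 1.
Proof.
have := sum_opinion x (fun=> 1); rewrite sumr_const card_ord.
under [in RHS]eq_bigr do rewrite mulr1.
by rewrite -[LHS]mulr1 => /(mulfI n_neq0).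
Qed.

Lemma gamma_ge0 x : 0 <= gamma R x.
Proof. by apply: sumr_ge0 => i _; apply: sqr_ge0. Qed.

Lemma alpha_sqr_le_gamma x i : alpha R x i ^+ 2 <= gamma R x.
Proof.
by rewrite /gamma (bigD1 i) //= lerDl sumr_ge0 // => j _; apply: sqr_ge0.
Qed.

Lemma alpha_le1 x i : alpha R x i <= 1.
Proof.
rewrite -(sum_alpha x) (bigD1 i) //= lerDl sumr_ge0 // => j _; exact: alpha_ge0.
Qed.

Lemma gamma_le1 x : gamma R x <= 1.
Proof.
rewrite -(sum_alpha x); apply: ler_sum => i _.
by rewrite expr2 ler_piMl ?alpha_ge0 ?alpha_le1.
Qed.

(** Each opinion count is an integer [m], so [m <= m ^ 2]; summing needs no relation between [k] and
    [n]. *)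
Lemma gamma_ge_inv x : n%:R^-1 <= gamma R x.
Proof.
rewrite -[leLHS]mul1r -[X in X * _ <= _](sum_alpha x) mulr_suml; apply: ler_sum => i _.
rewrite expr2 /alpha; set m := #|_|.
have -> : m%:R / n%:R / n%:R = m%:R * (n%:R^-1 * n%:R^-1) :> R by rewrite mulrA.
have -> : m%:R / n%:R * (m%:R / n%:R) = (m * m)%:R * (n%:R^-1 * n%:R^-1) :> R.
  by rewrite natrM; ring.
rewrite ler_wpM2r ?mulr_ge0 ?invr_ge0 ?ler0n // ler_nat.
by case: m => // m; rewrite leq_pmulr.
Qed.

Lemma sum_agree x : \sum_u \sum_v (x u == x v)%:R = n%:R ^+ 2 * gamma R x.
Proof.
under eq_bigr do under eq_bigr do rewrite eq_sym.
under eq_bigr do rewrite -alpha_count.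
rewrite (sum_opinion x (fun i => n%:R * alpha R x i)) expr2 -mulrA; congr (_ * _).
by rewrite mulr_sumr; apply: eq_bigr => i _; rewrite mulrCA expr2.
Qed.

Lemma sum_agree_on x j :
  \sum_u \sum_v ((x u == x v) && (x u == j))%:R = n%:R ^+ 2 * alpha R x j ^+ 2.
Proof.
under eq_bigr => u _.
  under eq_bigr do rewrite andbC -mulnb natrM eq_sym [x u == x _]eq_sym.
  rewrite -mulr_sumr -alpha_count; over.
rewrite (sum_opinion x (fun i => (j == i)%:R * (n%:R * alpha R x i))).
rewrite (bigD1 j) //= eqxx mul1r big1 ?addr0; first by ring.
by move=> i; rewrite eq_sym => /negbTE ->; rewrite mul0r mulr0.
Qed.

(** The first two samples agree on [j] with probability [alpha ^ 2]; they disagree with probability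
    [1 - gamma], and then an independent third sample decides. *)
Lemma maj3_updE x v j :
  maj3_upd R x v j = alpha R x j ^+ 2 + (1 - gamma R x) * alpha R x j.
Proof.
rewrite /maj3_upd natr_card_set.
have -> : \sum_w (maj3_out x w == j)%:R =
    \sum_u \sum_v \sum_w (maj3_out x (u, v, w) == j)%:R :> R.
  by rewrite !pair_bigA /=; apply: eq_bigr => -[[]].
have out u w : \sum_z (maj3_out x (u, w, z) == j)%:R =
    ((x u == x w) && (x u == j))%:R * n%:R +
    (1 - (x u == x w)%:R) * (n%:R * alpha R x j) :> R.
  rewrite /maj3_out; case: (x u == x w) => /=.
    by rewrite subrr mul0r addr0 sumr_const card_ord mulr_natr.
  by rewrite mul0r add0r subr0 mul1r alpha_count.
under eq_bigr do under eq_bigr do rewrite out.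
under eq_bigr do rewrite big_split /= -!mulr_suml.
rewrite big_split /= -!mulr_suml sum_agree_on.
under eq_bigr do rewrite sumrB.
rewrite sumrB sum_agree !sumr_const !card_ord -mulr_natr.
by field.
Qed.

Lemma choice2_updE x v j :
  choice2_upd R x v j = alpha R x j ^+ 2 + (1 - gamma R x) * (x v == j)%:R.
Proof.
rewrite /choice2_upd natr_card_set.
have -> : \sum_w (choice2_out x v w == j)%:R =
    \sum_u \sum_w (choice2_out x v (u, w) == j)%:R :> R.
  by rewrite !pair_bigA /=; apply: eq_bigr => -[].
have out u w : (choice2_out x v (u, w) == j)%:R =
    ((x u == x w) && (x u == j))%:R + (1 - (x u == x w)%:R) * (x v == j)%:R :> R.
  rewrite /choice2_out; case: (x u == x w) => /=; first by rewrite subrr mul0r addr0.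
  by rewrite add0r subr0 mul1r.
under eq_bigr do under eq_bigr do rewrite out.
under eq_bigr do rewrite big_split /= -!mulr_suml.
rewrite big_split /= -!mulr_suml sum_agree_on.
under eq_bigr do rewrite sumrB.
rewrite sumrB sum_agree !sumr_const !card_ord -mulr_natr.
by field.
Qed.

(** The difference is the variance of [alpha R x i] when [i] is drawn with probability
    [alpha R x i]. *)
Lemma gamma_sqr_le_sum_cube x : gamma R x ^+ 2 <= \sum_i alpha R x i ^+ 3.
Proof.
rewrite -subr_ge0; set g := gamma R x.
have -> : \sum_i alpha R x i ^+ 3 - g ^+ 2 =
    \sum_i alpha R x i * (alpha R x i - g) ^+ 2.
  transitivity (\sum_i (alpha R x i ^+ 3 - 2 * g * alpha R x i ^+ 2 + g ^+ 2 * alpha R x i)).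
    by rewrite big_split sumrB /= -!mulr_sumr sum_alpha -/(gamma R x) -/g; ring.
  by apply: eq_bigr => i _; ring.
by apply: sumr_ge0 => i _; rewrite mulr_ge0 ?alpha_ge0 ?sqr_ge0.
Qed.

(** Expected fraction of opinion [i] after one round; both dynamics share it, so one drift argument
    serves both. *)
Definition mean_alpha x i : R := alpha R x i * (1 + alpha R x i - gamma R x).

(** Expand each square and drop [(alpha * (alpha - gamma)) ^ 2]; the rest sums to at least [gamma]
    by the cube bound. *)
Lemma sum_mean_alpha_sqr_ge x : gamma R x <= \sum_i mean_alpha x i ^+ 2.
Proof.
set g := gamma R x; have cube := gamma_sqr_le_sum_cube x.
apply: le_trans (_ : \sum_i ((1 - 2 * g) * alpha R x i ^+ 2 + 2 * alpha R x i ^+ 3) <= _).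
  rewrite big_split /= -!mulr_sumr -/(gamma R x) -/g; rewrite -/g in cube; nra.
apply: ler_sum => i _; rewrite /mean_alpha -/g -subr_ge0.
have -> : (alpha R x i * (1 + alpha R x i - g)) ^+ 2 -
  ((1 - 2 * g) * alpha R x i ^+ 2 + 2 * alpha R x i ^+ 3) =
  (alpha R x i * (alpha R x i - g)) ^+ 2 by ring.
exact: sqr_ge0.
Qed.

Lemma sum_mean_alpha_sqr_le x : \sum_i mean_alpha x i ^+ 2 <= 4 * gamma R x.
Proof.
rewrite /gamma mulr_sumr; apply: ler_sum => i _.
have a0 := alpha_ge0 x i; have a1 := alpha_le1 x i.
have g0 := gamma_ge0 x; have g1 := gamma_le1 x.
have -> : 4 * alpha R x i ^+ 2 = (alpha R x i * 2) ^+ 2 by ring.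
rewrite lerXn2r ?nnegrE ?mulr_ge0 //; first by lra.
by rewrite ler_wpM2l //; lra.
Qed.

(** Counts without [v] do not see a change at [v], so the opinion of [v] enters [n ^ 2 * gamma] only
    through one linear term. *)
Definition count_others y v i : R := \sum_(u | u != v) (y u == i)%:R.

Lemma count_others_ge0 y v i : 0 <= count_others y v i.
Proof. exact: sumr_ge0. Qed.

Lemma alpha_others y v i :
  n%:R * alpha R y i = (y v == i)%:R + count_others y v i.
Proof. by rewrite alpha_count (bigD1 v). Qed.

Lemma count_others_update y v j i :
  count_others (update y v j) v i = count_others y v i.
Proof. by apply: eq_bigr => u /negbTE uv; rewrite updateE uv. Qed.

Lemma gamma_others y v :
  n%:R ^+ 2 * gamma R y =
  1 + 2 * count_others y v (y v) + \sum_i count_others y v i ^+ 2.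
Proof.
rewrite mulr_sumr.
transitivity (\sum_i ((y v == i)%:R * (1 + 2 * count_others y v i) +
    count_others y v i ^+ 2)).
  apply: eq_bigr => i _; rewrite -exprMn (alpha_others y v).
  by case: (y v == i); rewrite /=; ring.
rewrite big_split /= (bigD1 (y v)) //= eqxx mul1r; congr (_ + _).
rewrite big1 ?addr0 // => i.
by rewrite eq_sym => /negbTE ->; rewrite mul0r.
Qed.

Lemma gamma_update y v i j :
  gamma R (update y v i) - gamma R (update y v j) =
  2 / n%:R ^+ 2 * (count_others y v i - count_others y v j).
Proof.
have gE i' : gamma R (update y v i') =
  (1 + 2 * count_others y v i' + \sum_l count_others y v l ^+ 2) / n%:R ^+ 2.
  have := gamma_others (update y v i') v.
  rewrite updateE eqxx count_others_update.
  under eq_bigr do rewrite count_others_update.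
  by move=> <-; rewrite mulrAC divff ?mul1r // expf_neq0.
by rewrite !gE; field.
Qed.

(** * Moments of [gamma] after one round, and the drift of the potential *)

Section Step.
Variables (q : 'I_n -> 'I_k -> R) (x : config n k).
Hypothesis q_ge0 : forall v j, 0 <= q v j.
Hypothesis q_sum1 : forall v, \sum_j q v j = 1.
Hypothesis q_mean : forall j, \sum_v q v j = n%:R * mean_alpha x j.

(** Sum over opinions of the variances of the new counts, each count being a sum of independent
    Bernoulli variables. *)
Definition step_noise : R := \sum_v \sum_j q v j * (1 - q v j).

Lemma expect_alpha_sqr i :
  n%:R ^+ 2 * expect q (fun y => alpha R y i ^+ 2) =
  (\sum_v q v i) ^+ 2 + \sum_v q v i * (1 - q v i).
Proof.
rewrite -expectZ.
rewrite (eq_expect _ (G := fun y => \sum_u \sum_v (y u == i)%:R * (y v == i)%:R)); last first.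
  move=> y; rewrite -exprMn alpha_count expr2 mulr_suml.
  by apply: eq_bigr => u _; rewrite mulr_sumr.
have marg v : \sum_j q v j * (j == i)%:R = q v i.
  by rewrite (bigD1 i) //= eqxx mulr1 big1 ?addr0 // => j /negbTE ->; rewrite mulr0.
rewrite expect_sum expr2 mulr_suml -big_split; apply: eq_bigr => u _ /=.
rewrite expect_sum mulr_sumr (bigD1 u) //= [in RHS](bigD1 u) //=.
rewrite (eq_expect _ (G := fun y => (y u == i)%:R)); last first.
  by move=> y; case: (y u == i); rewrite ?mulr1 ?mulr0.
rewrite (expect_coord q_sum1 u (fun j => (j == i)%:R)) marg.
have -> : \sum_(v | v != u) expect q (fun y => (y u == i)%:R * (y v == i)%:R) =
    \sum_(v | v != u) q u i * q v i.
  apply: eq_bigr => v vu.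
  rewrite (expect_coord2 q_sum1 (fun j => (j == i)%:R) (fun j => (j == i)%:R)) 1?eq_sym //.
  by rewrite !marg.
by ring.
Qed.

Lemma expect_gamma :
  expect q (gamma R (k := k)) = \sum_i mean_alpha x i ^+ 2 + step_noise / n%:R ^+ 2.
Proof.
have n2 : n%:R ^+ 2 != 0 :> R by rewrite expf_neq0.
apply: (mulfI n2); rewrite mulrDr [_ * (step_noise / _)]mulrC divfK //.
rewrite {1}/gamma expect_sum mulr_sumr.
under eq_bigr do rewrite expect_alpha_sqr q_mean exprMn.
by rewrite big_split /= -mulr_sumr /step_noise exchange_big.
Qed.

Lemma step_noise_le : step_noise <= n%:R.
Proof.
rewrite -[X in _ <= X%:R]card_ord -sumr_const; apply: ler_sum => v _.
rewrite -[leRHS](q_sum1 v); apply: ler_sum => j _.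
by rewrite ler_piMr // gerBl.
Qed.

(** Efron-Stein with the old opinion [x v] as reference value: the difference at [v] vanishes unless
    [v] changes opinion, which has probability at most [rho]. *)
Lemma variance_gamma_le (rho : R) : (forall v, 1 - q v (x v) <= rho) ->
  expect q (fun y => gamma R y ^+ 2) - expect q (gamma R (k := k)) ^+ 2 <=
  4 * rho / n%:R * expect q (gamma R (k := k)).
Proof.
move=> stay; apply: le_trans (efron_stein q_ge0 q_sum1 x _) _.
have -> : 4 * rho / n%:R * expect q (gamma R (k := k)) =
    \sum_(v < n) expect q (fun y => 4 * rho / n%:R ^+ 2 * gamma R y).
  rewrite sumr_const card_ord -mulr_natl expectZ.
  by field.
(* Averaging over coordinate [v] first freezes the leave-one-out counts [r]. *)
apply: ler_sum => v _; rewrite -(expect_avg q_sum1 v); apply: ler_expect => // y.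
rewrite /avg; pose r := count_others y v.
have r0 j : 0 <= r j := count_others_ge0 y v j.
have -> : \sum_j q v j * (gamma R (update y v j) -
      gamma R (update (update y v j) v (x v))) ^+ 2 =
    4 / n%:R ^+ 4 * \sum_j q v j * (r j - r (x v)) ^+ 2.
  rewrite mulr_sumr; apply: eq_bigr => j _.
  by rewrite update_update gamma_update /r; field.
(* As [r >= 0], the squared difference is at most [r j ^ 2 + r (x v) ^ 2]. The first term uses that
   each [q v j] with [j != x v] is at most [rho], the second that their sum is. *)
have le_rho : \sum_j q v j * (r j - r (x v)) ^+ 2 <= rho * \sum_j r j ^+ 2.
  rewrite (bigD1 (x v)) //= subrr expr0n mulr0 add0r [in leRHS](bigD1 (x v)) //=.
  have q_rest : \sum_(j | j != x v) q v j <= rho.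
    by apply: le_trans (stay v); rewrite -(q_sum1 v) [in leRHS](bigD1 (x v)) //= addrAC subrr add0r.
  have q_le j : j != x v -> q v j <= rho.
    by move=> jx; apply: le_trans q_rest; rewrite (bigD1 j) //= lerDl sumr_ge0.
  apply: le_trans (_ : \sum_(j | j != x v) (rho * r j ^+ 2 + q v j * r (x v) ^+ 2) <= _).
    apply: ler_sum => j jx; apply: le_trans (_ : q v j * (r j ^+ 2 + r (x v) ^+ 2) <= _).
      by rewrite ler_wpM2l // sqrrB; have := mulr_ge0 (r0 j) (r0 (x v)); lra.
    by rewrite mulrDr lerD2r ler_wpM2r ?sqr_ge0 ?q_le.
  rewrite big_split /= -mulr_sumr -mulr_suml mulrDr addrC lerD2r.
  by rewrite ler_wpM2r ?sqr_ge0.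
have r_le : \sum_j r j ^+ 2 <= n%:R ^+ 2 * gamma R y.
  by rewrite (gamma_others y v) lerDr addr_ge0 // mulr_ge0 // r0.
have rho0 : 0 <= rho.
  apply: le_trans (stay v); rewrite subr_ge0 -(q_sum1 v) (bigD1 (x v)) //=.
  by rewrite lerDl sumr_ge0.
have -> : 4 * rho / n%:R ^+ 2 * gamma R y =
    4 / n%:R ^+ 4 * (rho * (n%:R ^+ 2 * gamma R y)) by field.
rewrite ler_wpM2l ?divr_ge0 ?exprn_ge0 //.
by apply: le_trans le_rho _; rewrite ler_wpM2l.
Qed.

(* The concave correction gamma ^ 2 / (160 thr) makes the potential bounded by
   40 thr while costing at most a constant fraction of the drift of gamma. *)
Definition potential (thr : R) y : R := gamma R y - gamma R y ^+ 2 / (160 * thr).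

Lemma potential_drift (thr rho : R) : 0 < thr -> gamma R x < thr ->
  (forall v, 1 - q v (x v) <= rho) -> n%:R * rho / 2 <= step_noise ->
  0 <= rho ->
  potential thr x + rho / (8 * n%:R) <= expect q (potential thr).
Proof.
move=> thr0 xthr stay noise rho0.
have var := variance_gamma_le stay.
rewrite /potential expectB.
rewrite (@eq_expect _ _ _ _ (fun y => gamma R y ^+ 2 / _)
  (fun y => (160 * thr)^-1 * gamma R y ^+ 2)); last by move=> y; rewrite mulrC.
rewrite expectZ.
set m := expect q (gamma R (k := k)) in var *.
set s := expect q (fun y => gamma R y ^+ 2) in var *.
set g := gamma R x in xthr *.
have g0 : 0 <= g := gamma_ge0 x.
set b := rho / n%:R.
have b0 : 0 <= b by rewrite divr_ge0.
have noise_ge : b / 2 <= step_noise / n%:R ^+ 2.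
  have -> : b / 2 = n%:R * rho / 2 / n%:R ^+ 2 by rewrite /b; field.
  by rewrite ler_wpM2r ?invr_ge0 ?exprn_ge0.
(* The noise term is at most [1 / n], hence at most [g]; this gives [m <= 5 * g] below. *)
have noise_le : step_noise / n%:R ^+ 2 <= g.
  apply: le_trans (gamma_ge_inv x).
  have -> : n%:R^-1 = n%:R / n%:R ^+ 2 :> R by field.
  by rewrite ler_wpM2r ?invr_ge0 ?exprn_ge0 ?step_noise_le.
have m_ge : g + b / 2 <= m.
  by rewrite /m expect_gamma lerD // sum_mean_alpha_sqr_ge.
have m_le : m <= 5 * g.
  rewrite /m expect_gamma; have := sum_mean_alpha_sqr_le x; rewrite -/g; lra.
have -> : rho / (8 * n%:R) = b / 8 by rewrite /b; field.
have {}var : s <= m ^+ 2 + 4 * b * m.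
  have -> : 4 * b * m = 4 * rho / n%:R * m by rewrite /b; ring.
  lra.
have thr160 : 0 < 160 * thr by rewrite mulr_gt0.
rewrite -subr_ge0.
have -> : m - (160 * thr)^-1 * s - (g - g ^+ 2 / (160 * thr) + b / 8) =
  ((m - g - b / 8) * (160 * thr) - s + g ^+ 2) / (160 * thr).
  by field; rewrite gt_eqF.
rewrite divr_ge0 ?(ltW thr160) //.
(* Here [s - g ^ 2] is at most [6 * thr * (m - g) + 20 * b * thr]. Dividing by [160 * thr] costs
   [6 / 160] of [m - g] plus [b / 8], and [m - g >= b / 2] leaves more than [b / 8]. *)
have : (m - g) * (m + g) <= (m - g) * (6 * thr).
  by rewrite ler_wpM2l //; lra.
have : b * m <= b * (5 * thr) by rewrite ler_wpM2l //; lra.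
have : b / 2 * thr <= (m - g) * thr by rewrite ler_wpM2r ?(ltW thr0) //; lra.
nra.
Qed.

End Step.
End Opinions.

(** * From drift to hitting probabilities *)

Lemma potential_le (R : realType) n k (thr : R) (y : config n k) : 0 < thr ->
  potential thr y <= 40 * thr.
Proof.
move=> thr0; rewrite /potential -subr_ge0; set g := gamma R y.
(* The parabola peaks at [g = 80 * thr], so the bound survives a round that overshoots the
   threshold. *)
have -> : 40 * thr - (g - g ^+ 2 / (160 * thr)) = (g - 80 * thr) ^+ 2 / (160 * thr).
  by field; rewrite gt_eqF.
by rewrite divr_ge0 ?sqr_ge0 // mulr_ge0 // ltW.
Qed.

Lemma potential_ge0 (R : realType) n k (thr : R) (y : config n k) :
  gamma R y < thr -> 0 <= potential thr y.
Proof.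
move=> ythr; have g0 := gamma_ge0 R y; have thr0 : 0 < thr by lra.
rewrite /potential -[X in X - _]mul1r expr2 -mulrA mulrCA mulrC -mulrBr.
rewrite mulr_ge0 // subr_ge0 ler_pdivrMr ?mulr_gt0 //; lra.
Qed.

(** The rate [rho] may depend on the configuration, while [d] is a uniform lower bound on the drift
    [rho / (8 * n)]. The condition on [T * d] brings survival over one block of rounds down to
    [1 / e]. *)
Lemma prob_hits_gamma_ge (R : realType) n k (upd : config n k -> 'I_n -> 'I_k -> R)
    (thr d T : R) (L : nat) (x0 : config n k) :
  (0 < n)%N ->
  (forall x v j, 0 <= upd x v j) ->
  (forall x v, \sum_j upd x v j = 1) ->
  (forall x j, \sum_v upd x v j = n%:R * mean_alpha R x j) ->
  0 < thr -> 0 < d ->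
  (forall x, gamma R x < thr -> exists2 rho, 8 * n%:R * d <= rho &
     (forall v, 1 - upd x v (x v) <= rho) /\ n%:R * rho / 2 <= step_noise (upd x)) ->
  1 <= ln (n%:R : R) -> 1 <= T -> expR 1 * (40 * thr) <= T * d ->
  4 * T * ln (n%:R : R) < L.+1%:R ->
  1 - n%:R^-1 <= prob_event upd x0 (hits_gamma (L := L) thr).
Proof.
move=> n0 upd_ge0 upd_sum1 upd_mean thr0 d0 drift ln1 T1 Td TL.
pose ok := [pred x : config n k | gamma R x < thr].
have M_ge0 x y : 0 <= step_prob upd x y by apply: prodr_ge0.
have M_sum1 x : \sum_y step_prob upd x y = 1 by apply: sum_prod_weight.
rewrite /prob_event (eq_bigl (fun tr : traj n k L => [exists t, ~~ ok (tr t)])); last first.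
  by move=> tr; apply: eq_existsb => t; rewrite /= -leNgt.
rewrite (sum_walk_hit ok L x0 M_sum1) lerB //.
(* [r] blocks of [N] rounds. Rounding up at most doubles [T] and [ln n], both at least 1, whence the
   factor 4 in the horizon. *)
pose N := (Num.truncn T).+1; pose r := (Num.truncn (ln (n%:R : R))).+1.
have T_ltN : T < N%:R by apply: truncnS_gt.
have ln_ltr : ln (n%:R : R) < r%:R by apply: truncnS_gt.
have N_le : N%:R <= 2 * T.
  have : (Num.truncn T)%:R <= T by rewrite truncn_le //; lra.
  by rewrite /N -natr1; lra.
have r_le : r%:R <= 2 * ln (n%:R : R).
  have : (Num.truncn (ln (n%:R : R)))%:R <= ln (n%:R : R) by rewrite truncn_le //; lra.
  by rewrite /r -natr1; lra.
have rN_le : (r * N <= L.+1)%N.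
  rewrite -(ler_nat R) natrM; apply: le_trans (ltW TL).
  have -> : 4 * T * ln (n%:R : R) = 2 * ln n%:R * (2 * T) by ring.
  by rewrite ler_pM.
apply: le_trans (survival_mono ok M_ge0 M_sum1 _ rN_le) _.
have step y : survival (step_prob upd) ok N y <= expR (- 1).
  have := @survival_drift R _ _ ok M_ge0 M_sum1 (potential thr) (40 * thr) d N y (ltW d0).
  have -> : (0 <= 40 * thr) by rewrite mulr_ge0 // ltW.
  move=> /(_ isT (fun z => potential_le z thr0) (@potential_ge0 _ _ _ thr)) drift_le.
  have {}drift_le : N%:R * d * survival (step_prob upd) ok N y <= 40 * thr.
    apply: drift_le => z zthr; have [rho d_le [stay noise]] := drift z zthr.
    have nR : 0 < n%:R :> R by rewrite ltr0n.
    have rho0 : 0 <= rho by apply: le_trans d_le; rewrite !mulr_ge0 // ltW.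
    apply: le_trans (potential_drift n0 (upd_ge0 z) (upd_sum1 z) (upd_mean z)
      thr0 zthr stay noise rho0).
    by rewrite lerD2l ler_pdivlMr ?mulr_gt0 // mulrC.
  have Nd0 : 0 < N%:R * d by rewrite mulr_gt0.
  rewrite -(ler_pM2l Nd0); apply: le_trans drift_le _.
  rewrite expRN ler_pdivlMr ?expR_gt0 // mulrC; apply: le_trans Td _.
  by rewrite ler_pM2r // ltW.
apply: le_trans (survival_mul M_ge0 r x0 step) _.
rewrite -expRM_natr -[n%:R^-1]lnK ?posrE ?invr_gt0 ?ltr0n // lnV ?posrE ?ltr0n //.
by rewrite ler_expR mulN1r lerN2 ltW.
Qed.

(** * Asymptotics in [n] and the treatment of small [n] *)

Lemma ln_div_sqrt_small (R : realType) (e : R) : 0 < e ->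
  exists n0 : nat, forall n : nat, (n0 <= n)%N ->
    1 <= ln (n%:R : R) /\ ln (n%:R : R) / Num.sqrt n%:R <= e.
Proof.
(* The two summands ensure that the fourth root of [n] is at least [4 / e] and that [ln n >= 1]. *)
move=> e0; pose b := (4 / e) ^+ 4 + expR 1.
exists (Num.truncn b).+1 => n n_ge.
have b_lt : b < n%:R by apply: lt_le_trans (truncnS_gt b) _; rewrite ler_nat.
have e4 : 0 < 4 / e by rewrite divr_gt0.
have e44 : 0 < (4 / e) ^+ 4 by rewrite exprn_gt0.
have exp1 := expR_gt0 (1 : R).
have n_pos : 0 < n%:R :> R by apply: lt_trans b_lt; rewrite addr_gt0.
split; first by rewrite -[leLHS]expRK ler_ln ?posrE //; rewrite /b in b_lt; lra.
pose s : R := Num.sqrt (Num.sqrt n%:R).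
have s_pos : 0 < s by rewrite !sqrtr_gt0.
have s2 : s ^+ 2 = Num.sqrt n%:R by rewrite sqr_sqrtr // sqrtr_ge0.
have s4 : s ^+ 4 = n%:R by rewrite (exprM s 2 2) s2 sqr_sqrtr // ltW.
have s_ge : 4 / e <= s.
  rewrite leNgt; apply/negP => s_lt; have := ltrXn2r 4 (ltW s_pos) s_lt.
  by rewrite s4 /= => /idP; apply/negP; rewrite -leNgt; rewrite /b in b_lt; lra.
(* With [s] the fourth root of [n], [ln n = 4 * ln s <= 4 * s], so the ratio is at most [4 / s]. *)
have ln_le : ln (n%:R : R) <= 4 * s.
  rewrite -s4 lnXn // -[leLHS]mulr_natl ler_pM2l //.
  have s_gt : -1 < s - 1 by lra.
  by have := le_ln1Dx s_gt; rewrite addrCA subrr addr0; lra.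
rewrite -s2 ler_pdivrMr ?exprn_gt0 //; apply: le_trans ln_le _.
rewrite expr2 mulrA ler_pM2r //; move: s_ge; rewrite ler_pdivrMr //; lra.
Qed.

(** For [n < n0] the constant [n0.+1] makes the lower bound negative. *)
Lemma whp_of_eventually (R : realType) (P : forall n k, config n k -> R) (n0 : nat) :
  (forall n k (x : config n k), 0 <= P n k x) ->
  (forall n k (x : config n k), (0 < n)%N -> (n0 <= n)%N -> 1 - n%:R^-1 <= P n k x) ->
  forall n k, (0 < n)%N -> forall x : config n k,
    1 - n0.+1%:R * (n%:R `^ (- 1)) <= P n k x.
Proof.
move=> P0 Plarge n k n_gt0 x; rewrite powRN powRr1 ?ler0n //.
have nR : 0 < n%:R :> R by rewrite ltr0n.
case: (leqP n0 n) => [n0n|nn0].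
  apply: le_trans (Plarge n k x n_gt0 n0n).
  by rewrite lerD2l lerN2 ler_peMl ?invr_ge0 ?ler1n // ltW.
apply: le_trans (P0 n k x); rewrite subr_le0 ler_pdivlMr // mul1r ler_nat.
exact: leqW (ltnW nn0).
Qed.

Lemma prob_event_ge0 (R : realType) n k (upd : config n k -> 'I_n -> 'I_k -> R) x0 L
    (A : pred (traj n k L)) :
  (forall x v j, 0 <= upd x v j) -> 0 <= prob_event upd x0 A.
Proof.
move=> upd0; apply: sumr_ge0 => tr _; rewrite mulr_ge0 //.
by apply: prodr_ge0 => t _; apply: prodr_ge0.
Qed.

(** * Means and noise of 3-Majority and 2-Choices *)

Section Dynamics.
Variables (R : realType) (n k : nat).
Hypothesis n_gt0 : (0 < n)%N.
Implicit Types (x : config n k) (v : 'I_n) (j : 'I_k).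

Let n_pos : 0 < n%:R :> R. Proof. by rewrite ltr0n. Qed.

Lemma maj3_upd_sum1 x v : \sum_j maj3_upd R x v j = 1.
Proof.
under eq_bigr do rewrite maj3_updE //.
by rewrite big_split /= -mulr_sumr sum_alpha // -/(gamma R x); ring.
Qed.

Lemma choice2_upd_sum1 x v : \sum_j choice2_upd R x v j = 1.
Proof.
under eq_bigr do rewrite choice2_updE //.
rewrite big_split /= -mulr_sumr -/(gamma R x) (bigD1 (x v)) //= eqxx big1 ?addr0.
  by rewrite mulr1; ring.
by move=> j; rewrite eq_sym => /negbTE ->.
Qed.

Lemma maj3_upd_mean x j : \sum_v maj3_upd R x v j = n%:R * mean_alpha R x j.
Proof.
under eq_bigr do rewrite maj3_updE //.
by rewrite sumr_const card_ord -mulr_natl /mean_alpha; ring.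
Qed.

Lemma choice2_upd_mean x j : \sum_v choice2_upd R x v j = n%:R * mean_alpha R x j.
Proof.
under eq_bigr do rewrite choice2_updE //.
rewrite big_split /= sumr_const card_ord -mulr_sumr -alpha_count // -[_ *+ n]mulr_natl.
by rewrite /mean_alpha; ring.
Qed.

(** All vertices have the same law [mean_alpha], so the noise is [n] times one minus its collision
    probability, which is at most [4 * gamma <= 1 / 2]. *)
Lemma maj3_noise x : gamma R x <= 8^-1 ->
  n%:R * 1 / 2 <= step_noise (maj3_upd R x).
Proof.
move=> g8; have p4 := sum_mean_alpha_sqr_le R n_gt0 x.
have updE v j : maj3_upd R x v j = mean_alpha R x j.
  by rewrite maj3_updE // /mean_alpha; ring.
have -> : step_noise (maj3_upd R x) = n%:R * (1 - \sum_j mean_alpha R x j ^+ 2).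
  rewrite -[X in X%:R * _]card_ord mulr_natl -sumr_const; apply: eq_bigr => v _.
  rewrite -[X in X - _](maj3_upd_sum1 x v) -sumrB.
  by apply: eq_bigr => j _; rewrite updE; ring.
by rewrite -mulrA ler_pM2l //; lra.
Qed.

Lemma choice2_stay x v :
  choice2_upd R x v (x v) = 1 - gamma R x + alpha R x (x v) ^+ 2.
Proof. by rewrite choice2_updE // eqxx mulr1 addrC. Qed.

(** Keep only the term of the vertex's own opinion. Each fraction is at most [1 / 4], so the cubes
    sum to at most [gamma / 4], and [(15 / 16) * (3 / 4) >= 1 / 2]. *)
Lemma choice2_noise x : gamma R x <= 16^-1 ->
  n%:R * gamma R x / 2 <= step_noise (choice2_upd R x).
Proof.
move=> g16; set g := gamma R x in g16 *.
have g0 : 0 <= g := gamma_ge0 R x.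
have ag i : alpha R x i ^+ 2 <= g by apply: alpha_sqr_le_gamma.
have upd1 v j : choice2_upd R x v j <= 1.
  rewrite -(choice2_upd_sum1 x v) (bigD1 j) //= lerDl sumr_ge0 // => i _.
  by rewrite divr_ge0.
have cube : \sum_i alpha R x i * alpha R x i ^+ 2 <= g / 4.
  rewrite /g /gamma mulr_suml; apply: ler_sum => i _.
  rewrite mulrC ler_wpM2l ?sqr_ge0 //.
  have := ag i; have := alpha_ge0 R x i; nra.
apply: le_trans (_ : \sum_v (1 - g) * (g - alpha R x (x v) ^+ 2) <= _); last first.
  apply: ler_sum => v _; rewrite (bigD1 (x v)) //=.
  apply: le_trans (_ : choice2_upd R x v (x v) * (1 - choice2_upd R x v (x v)) <= _).
    rewrite choice2_stay -/g; have := ag (x v); have := sqr_ge0 (alpha R x (x v)); nra.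
  by rewrite lerDl sumr_ge0 // => j _; rewrite mulr_ge0 ?subr_ge0 // divr_ge0.
rewrite -mulr_sumr sumrB sumr_const card_ord -[g *+ n]mulr_natl.
rewrite (sum_opinion n_gt0 x (fun i => alpha R x i ^+ 2)) -mulrBr mulrCA -mulrA.
by rewrite ler_pM2l //; nra.
Qed.

End Dynamics.

(** * Choice of constants and conclusion *)

Unset Implicit Arguments.

Theorem theorem2p2 (R : realType) (cst : R) (hcst : 0 < cst) :
  (exists (C c C' : R), 0 < c /\
    forall (n k : nat), (0 < n)%N -> (0 < k)%N -> (k <= n)%N ->
    forall x0 : config n k,
      1 - C' * (n%:R `^ (- c)) <=
      prob_event (@maj3_upd R n k) x0
        (hits_gamma (L := Num.truncn (C * Num.Def.sqrtr n%:R * ln n%:R ^+ 2))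
           (cst * ln n%:R / Num.Def.sqrtr n%:R))) /\
  (exists (C c C' : R), 0 < c /\
    forall (n k : nat), (0 < n)%N -> (0 < k)%N -> (k <= n)%N ->
    forall x0 : config n k,
      1 - C' * (n%:R `^ (- c)) <=
      prob_event (@choice2_upd R n k) x0
        (hits_gamma (L := Num.truncn (C * n%:R * ln n%:R ^+ 3))
           (cst * ln n%:R ^+ 2 / n%:R))).
Proof.
have e1 := expR_gt0 (1 : R).
(* [320 = 8 * 40], from the drift [rho / (8 * n)] and the potential bound [40 * thr]; the added 1
   gives [T >= 1]. *)
pose D := 320 * expR 1 * cst + 1.
have D1 : 1 <= D by rewrite lerDr !mulr_ge0 // ltW.
(* Chosen so that for large [n] both thresholds are at most [1 / 16], as the noise bounds
   require. *)
pose e := (16 * (cst + 1))^-1.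
have e0 : 0 < e by rewrite invr_gt0 mulr_gt0 // addr_gt0.
have ce : cst * e <= 16^-1.
  by rewrite /e ler_pdivrMr ?mulr_gt0 ?addr_gt0 //; lra.
have e_le1 : e <= 1 by rewrite invf_le1 ?mulr_gt0 ?addr_gt0 //; lra.
have [n0 n0P] := ln_div_sqrt_small e0.
split; exists (4 * D), 1, n0.+1%:R; split=> // n k n_gt0 _ _ x0.
  move: n k n_gt0 x0; apply: (@whp_of_eventually R (fun n k x0 =>
    prob_event (@maj3_upd R n k) x0
        (hits_gamma (L := Num.truncn (4 * D * Num.Def.sqrtr n%:R * ln n%:R ^+ 2))
           (cst * ln n%:R / Num.Def.sqrtr n%:R)))).
    by move=> n k x; apply: prob_event_ge0 => y v j; rewrite divr_ge0 ?exprn_ge0.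
  move=> n k x n_gt0 /n0P [l1 le_e].
  have n_ge1 : 1 <= n%:R :> R by rewrite ler1n.
  have n_pos : 0 < n%:R :> R by rewrite ltr0n.
  set s := Num.sqrt n%:R in le_e *; set l := ln n%:R in l1 le_e *.
  have s1 : 1 <= s by rewrite -[leLHS]sqrtr1 ler_sqrt.
  have s0 : 0 < s by apply: lt_le_trans s1.
  have sn : s ^+ 2 = n%:R by rewrite sqr_sqrtr // ltW.
  have l0 : 0 < l by apply: lt_le_trans l1.
  (* Here [rho = 1], so [d = 1 / (8 * n)]. *)
  apply: (@prob_hits_gamma_ge R n k _ _ (8 * n%:R)^-1 (D * s * l)) => //.
  - by move=> y v j; rewrite divr_ge0 ?exprn_ge0.
  - exact: maj3_upd_sum1.
  - exact: maj3_upd_mean.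
  - by rewrite divr_gt0 ?mulr_gt0.
  - by rewrite invr_gt0 mulr_gt0.
  - move=> y ythr; exists 1; first by rewrite divff // gt_eqF // mulr_gt0.
    split; first by move=> v; rewrite gerBl divr_ge0 ?exprn_ge0.
    apply: maj3_noise => //; move: ythr; rewrite -mulrA => ythr.
    have := ler_wpM2l (ltW hcst) le_e; lra.
  - by rewrite !mulr_ege1.
  - rewrite -sn.
    have -> : D * s * l * (8 * s ^+ 2)^-1 = D / 8 * (l / s) by field; rewrite gt_eqF.
    have -> : expR 1 * (40 * (cst * l / s)) = 40 * expR 1 * cst * (l / s) by ring.
    by rewrite ler_pM2r ?divr_gt0 // /D; lra.
  - have -> : 4 * (D * s * l) * l = 4 * D * s * l ^+ 2 by ring.
    exact: truncnS_gt.
move: n k n_gt0 x0; apply: (@whp_of_eventually R (fun n k x0 =>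
  prob_event (@choice2_upd R n k) x0
        (hits_gamma (L := Num.truncn (4 * D * n%:R * ln n%:R ^+ 3))
           (cst * ln n%:R ^+ 2 / n%:R)))).
  by move=> n k x; apply: prob_event_ge0 => y v j; rewrite divr_ge0 ?exprn_ge0.
move=> n k x n_gt0 /n0P [l1 le_e].
have n_ge1 : 1 <= n%:R :> R by rewrite ler1n.
have n_pos : 0 < n%:R :> R by rewrite ltr0n.
have n_neq0 : n%:R != 0 :> R by rewrite gt_eqF.
set l := ln n%:R in l1 le_e *.
have l0 : 0 < l by apply: lt_le_trans l1.
have thr_le : cst * l ^+ 2 / n%:R <= 16^-1.
  (* The threshold is [cst * (l / sqrt n) ^ 2 <= cst * e ^ 2 <= cst * e], since [e <= 1]. *)
  rewrite -[X in _ / X]sqr_sqrtr ?(ltW n_pos) // -mulrA -expr_div_n.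
  have ls0 : 0 <= l / Num.sqrt n%:R by rewrite divr_ge0 ?sqrtr_ge0 ?(ltW l0).
  apply: le_trans ce; rewrite ler_pM2l // expr2.
  by apply: le_trans (ler_pM ls0 ls0 le_e le_e) _; rewrite ler_piMl // ltW.
(* Here [rho = gamma >= 1 / n], so the uniform drift is only [d = 1 / (8 * n ^ 2)]. *)
apply: (@prob_hits_gamma_ge R n k _ _ (8 * n%:R ^+ 2)^-1 (D * n%:R * l ^+ 2)) => //.
- by move=> y v j; rewrite divr_ge0 ?exprn_ge0.
- exact: choice2_upd_sum1.
- exact: choice2_upd_mean.
- by rewrite divr_gt0 ?mulr_gt0 ?exprn_gt0.
- by rewrite invr_gt0 mulr_gt0 ?exprn_gt0.
- move=> y ythr; exists (gamma R y).
    have -> : 8 * n%:R * (8 * n%:R ^+ 2)^-1 = n%:R^-1 :> R by field.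
    exact: gamma_ge_inv.
  split; last by apply: choice2_noise => //; lra.
  by move=> v; rewrite choice2_stay //; have := sqr_ge0 (alpha R y (y v)); lra.
- by rewrite !mulr_ege1 ?exprn_ege1.
- have -> : D * n%:R * l ^+ 2 * (8 * n%:R ^+ 2)^-1 = D / 8 * (l ^+ 2 / n%:R) by field.
  have -> : expR 1 * (40 * (cst * l ^+ 2 / n%:R)) =
    40 * expR 1 * cst * (l ^+ 2 / n%:R) by ring.
  by rewrite ler_pM2r ?divr_gt0 ?exprn_gt0 // /D; lra.
- have -> : 4 * (D * n%:R * l ^+ 2) * l = 4 * D * n%:R * l ^+ 3 by ring.
  exact: truncnS_gt.
Qed.
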